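(* Let $k\ge1$, $n\ge2$, $m=kn+1$, $n'=n-1$, $m'=kn'+1$, and $D'\in\mathcal D_{m',n'}$. Suppose $\Phi^{-1}(D')$ is cut at a vertex (other than its endpoint) of rank $r<m'$ (rank in the $(m',n')$ system) as $\Phi^{-1}(D')=AB$, and let $D\in\mathcal D_{m,n}$ be defined by $\Phi^{-1}(D)=N\,B\,A\,E^k$ (a North step, then $B$, then $A$, then $k$ East steps). Then $\mathrm{cobounce}(D)=\mathrm{cobounce}(D')+r$; equivalently, $\mathrm{bounce}(D)=\mathrm{bounce}(D')+n'k-r$.
   Context: For coprime $m,n$, $\mathcal D_{m,n}$ is the set of lattice paths from $(0,0)$ to $(m,n)$ with unit North and East steps staying weakly above the segment from $(0,0)$ to $(m,n)$. The rank of $(x,y)$ is $ym-xn$. The sweep map $\Phi:\mathcal D_{m,n}\to\mathcal D_{m,n}$ sends $P$ to the path whose $i$-th step is North iff the step of $P$ with the $i$-th smallest starting rank is North; it is a bijection when $m=kn+1$ (and the path $NBAE^k$ above lies in $\mathcal D_{m,n}$). $\mathrm{area}(P)$ is the number of unit cells between $P$ and the main diagonal not cut by the diagonal. $\mathrm{bounce}(D):=\mathrm{area}(\Phi^{-1}(D))$, and for $D\in\mathcal D_{kn+1,n}$, $\mathrm{cobounce}(D):=k\binom n2-\mathrm{bounce}(D)$ (similarly with $n'$ for $D'$). *)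

(* Defs.v *)
From mathcomp Require Import all_boot all_order all_algebra.

Set Implicit Arguments.
Unset Strict Implicit.
Unset Printing Implicit Defensive.

Import Order.TTheory GRing.Theory Num.Theory.
Local Open Scope ring_scope.

(* A lattice path starting at (0,0) is the word of its unit steps. *)
Definition North : bool := true.
Definition East : bool := false.

Definition endpt (w : seq bool) : nat * nat :=
  (count_mem East w, count_mem North w).

Definition vertex (P : seq bool) (i : nat) : nat * nat := endpt (take i P).

Definition rank (m n : nat) (p : nat * nat) : int :=
  p.2%:Z * m%:Z - p.1%:Z * n%:Z.

(* The half-plane weakly above the line through (0,0) and (m,n) is           *)
(* {rank >= 0}; it is convex, so testing the vertices of P is enough.        *)
Definition dyck (m n : nat) : pred (seq bool) := fun P =>
  (endpt P == (m, n)) &&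
  all (fun i => 0 <= rank m n (vertex P i)) (iota 0 (size P).+1).

(* For coprime m, n the starting ranks of the steps of a path in dyck m n    *)
(* are pairwise distinct, so the sorted list of step indices is unambiguous. *)
Definition sweep (m n : nat) (P : seq bool) : seq bool :=
  [seq nth East P i
     | i <- sort (fun i j => rank m n (vertex P i) <= rank m n (vertex P j))
                 (iota 0 (size P))].

(* The preimage of D in dyck m n under the sweep map, which is a bijection   *)
(* of dyck m n for m = k n + 1. The junk value [::], returned when there is  *)
(* no preimage, is not in dyck m n unless m = n = 0.                         *)
Definition sweep_inv (m n : nat) (D : seq bool) : seq bool :=
  if [pick P : (m + n).-tuple bool | dyck m n P && (sweep m n P == D)]
    is Some P then tval P else [::].

(* The cell (x, y) is the square [x, x+1] * [y, y+1]; it lies below P when   *)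
(* the North step of P from height y to y+1 has abscissa at most x.          *)
Definition below (P : seq bool) (x y : nat) : bool :=
  has (fun i => [&& nth East P i == North,
                    (vertex P i).2 == y & ((vertex P i).1 <= x)%N])
      (iota 0 (size P)).

(* A cell above the diagonal is not cut by it when its corner of least rank, *)
(* the south-east corner (x+1, y), is still weakly above the diagonal.       *)
Definition area (m n : nat) (P : seq bool) : nat :=
  #|[set c : 'I_m * 'I_n |
      below P c.1 c.2 && (0 <= rank m n ((c.1).+1, c.2 : nat))]|.

Definition bounce (m n : nat) (D : seq bool) : nat :=
  area m n (sweep_inv m n D).

Definition cobounce (k n : nat) (D : seq bool) : int :=
  (k * 'C(n, 2))%N%:Z - (bounce (k * n + 1) n D)%:Z.

(* Main.v *)
Require Import Defs.
From mathcomp Require Import all_boot all_order all_algebra.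
From mathcomp Require Import zify ring.

(** In row [y] the cells that the diagonal does not cut are those of abscissa
    less than [y m / n], and they lie below the path from the abscissa of its
    North step on. Summing over the rows, the area of a Dyck path and the
    number of its inversions, i.e. of the pairs (East step, later North step),
    add up to the sum of the [floor (y m / n)]. For [m = k n + 1] this sum is
    [k * 'C(n, 2)], so cobounce counts the inversions of the preimage under
    the sweep map. Passing from [A B] to [N B A E^k] trades the pairs (East in
    A, North in B) for the pairs (East in B, North in A), and the difference
    of these two numbers is the rank of the endpoint of [A]. *)

Set Implicit Arguments.
Unset Strict Implicit.
Unset Printing Implicit Defensive.

Import Order.TTheory GRing.Theory Num.Theory.
Local Open Scope ring_scope.

Fixpoint inversions (w : seq bool) : nat :=
  if w is b :: w' then ((b == East) * count_mem North w' + inversions w')%N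
  else 0%N.

(* Abscissa of the North step leaving height [y]; it is a junk value when
   [count_mem North w <= y]. *)
Fixpoint north_abscissa (w : seq bool) (y : nat) : nat :=
  if w is b :: w' then
    if b == East then (north_abscissa w' y).+1
    else if y is y'.+1 then north_abscissa w' y' else 0%N
  else 0%N.

Lemma inversions_cat (u v : seq bool) :
  inversions (u ++ v) =
    (inversions u + inversions v + count_mem East u * count_mem North v)%N.
Proof.
elim: u => [|b u IHu] /=; first by rewrite mul0n addn0.
by rewrite IHu count_cat; case: (b == East) => /=; lia.
Qed.

Lemma inversions_cat_nseq_East (w : seq bool) (k : nat) :
  inversions (w ++ nseq k East) = inversions w.
Proof.
rewrite inversions_cat count_nseq muln0 addn0.
by elim: k => [|k IHk] /=; rewrite ?addn0 // count_nseq.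
Qed.

Lemma inversions_catC (m n : nat) (u v : seq bool) : endpt (u ++ v) = (m, n) ->
  (inversions (v ++ u))%:Z = (inversions (u ++ v))%:Z + rank m n (endpt u).
Proof.
case=> <- <-; rewrite /rank /endpt /= !inversions_cat !count_cat.
by rewrite !PoszD !PoszM; ring.
Qed.

Lemma sum_north_abscissa (w : seq bool) :
  (\sum_(y < count_mem North w) north_abscissa w y)%N = inversions w.
Proof.
elim: w => [|[] w IHw] /=; first by rewrite big_ord0.
- by rewrite add1n big_ord_recl /= !add0n -IHw.
- by rewrite add0n (eq_bigr _ (fun y _ => esym (add1n _)))
     big_split sum1_card card_ord mul1n IHw.
Qed.

Lemma belowE (w : seq bool) (x y : nat) : (y < count_mem North w)%N ->
  below w x y = (north_abscissa w y <= x)%N.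
Proof.
elim: w x y => [//|b w IHw] x y lt_y.
rewrite /below /= -[1%N]addn0 iotaDl has_map /vertex /endpt /=.
case: b lt_y => /= lt_y.
- case: y lt_y => [//|y]; rewrite add1n ltnS => lt_y /=.
  by rewrite -(IHw x y).
- case: x => [|x]; last by rewrite ltnS -(IHw x y).
  by apply/hasPn => i _ /=; rewrite add1n ltn0 !andbF.
Qed.

Lemma vertex_north_abscissa (w : seq bool) (y : nat) :
  (y < count_mem North w)%N ->
  exists2 i, (i < size w)%N & vertex w i = (north_abscissa w y, y).
Proof.
move=> lt_y; have := leqnn (north_abscissa w y).
rewrite -belowE // => /hasP[i Pi /and3P[north_i /eqP height_i le_abscissa]].
exists i; first by rewrite mem_iota in Pi.
rewrite [LHS]surjective_pairing height_i; congr (_, _).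
apply/anti_leq; rewrite le_abscissa -belowE //.
by apply/hasP; exists i => //; rewrite north_i height_i eqxx leqnn.
Qed.

Lemma rank_ge0 (m n : nat) (p : nat * nat) : (0 < n)%N ->
  (0 <= rank m n p) = (p.1 <= p.2 * m %/ n)%N.
Proof. by move=> n_gt0; rewrite leq_divRL // subr_ge0 -!PoszM lez_nat. Qed.

Lemma dyck_north_abscissa (m n : nat) (P : seq bool) (y : nat) :
  dyck m n P -> (y < n)%N -> (north_abscissa P y <= y * m %/ n)%N.
Proof.
move=> /andP[/eqP[_ cN] /allP vertex_ge0] lt_y.
have [|i lt_i vertex_i] := @vertex_north_abscissa P y; first by rewrite cN.
have := vertex_ge0 i; rewrite mem_iota ltnS (ltnW lt_i) vertex_i => /(_ isT).
by rewrite rank_ge0 // (leq_ltn_trans _ lt_y).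
Qed.

Lemma sum_ord_between (m a b : nat) : (b <= m)%N ->
  (\sum_(x < m) (a <= x < b) = b - a)%N.
Proof.
move=> le_bm; rewrite -[RHS]muln1 -sum_nat_const_nat big_geq_mkord.
rewrite (big_ord_widen_cond m (leq a) (fun=> 1%N)) // [RHS]big_mkcond.
by apply: eq_bigr => x _; case: ifP.
Qed.

Lemma area_sum_rows (m n : nat) (P : seq bool) : count_mem North P = n ->
  area m n P = (\sum_(y < n) (y * m %/ n - north_abscissa P y))%N.
Proof.
move=> cN; pose uncut (x : 'I_m) (y : 'I_n) :=
  below P x y && (0 <= rank m n (x.+1, y : nat)).
have -> : area m n P = (\sum_(x < m) \sum_(y < n) uncut x y)%N.
  rewrite pair_bigA /area cardsE -sum1_card big_mkcond.
  by apply: eq_bigr => c _; rewrite unfold_in -/(uncut c.1 c.2); case: uncut.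
rewrite exchange_big; apply: eq_bigr => y _ /=.
have n_gt0 : (0 < n)%N by apply: leq_ltn_trans (ltn_ord y).
have le_row : (y * m %/ n <= m)%N.
  by rewrite -[leqRHS](mulKn m n_gt0) leq_div2r // leq_mul // ltnW.
rewrite -(sum_ord_between _ le_row); apply: eq_bigr => x _.
by rewrite /uncut belowE ?cN // rank_ge0.
Qed.

Lemma area_add_inversions (m n : nat) (P : seq bool) : dyck m n P ->
  (area m n P + inversions P = \sum_(y < n) y * m %/ n)%N.
Proof.
move=> dP; have /andP[/eqP[_ cN] _] := dP.
rewrite (area_sum_rows _ cN) -sum_north_abscissa cN -big_split /=.
by apply: eq_bigr => y _; rewrite subnK // dyck_north_abscissa.
Qed.

Lemma sum_floor_diagonal (k n : nat) :
  (\sum_(y < n) y * (k * n + 1) %/ n = k * 'C(n, 2))%N.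
Proof.
rewrite -bin2_sum big_mkord big_distrr /=; apply: eq_bigr => y _.
have n_gt0 : (0 < n)%N by apply: leq_ltn_trans (ltn_ord y).
by rewrite mulnDr muln1 mulnCA mulnA divnMDl // divn_small // addn0.
Qed.

Lemma sweep_inv_dyck (m n : nat) (D : seq bool) :
  sweep_inv m n D <> [::] -> dyck m n (sweep_inv m n D).
Proof. by rewrite /sweep_inv; case: pickP => // P /andP[]. Qed.

Lemma cobounce_inversions (k n : nat) (D P : seq bool) :
  sweep_inv (k * n + 1) n D = P -> dyck (k * n + 1) n P ->
  cobounce k n D = (inversions P)%:Z.
Proof.
move=> sweep_inv_D dP; rewrite /cobounce /bounce sweep_inv_D.
by rewrite -sum_floor_diagonal -(area_add_inversions dP) PoszD addrC addKr.
Qed.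

Theorem theorem4p8 (k n m n' m' : nat) (r : int) (D' A B D : seq bool)
  (hk : (1 <= k)%N) (hn : (2 <= n)%N)
  (hm : m = (k * n + 1)%N) (hn' : n' = (n - 1)%N) (hm' : m' = (k * n' + 1)%N)
  (hD' : dyck m' n' D')
  (hcut : sweep_inv m' n' D' = A ++ B)
  (hB : B <> [::])
  (hrank : rank m' n' (endpt A) = r)
  (hr : r < m'%:Z)
  (hD : dyck m n D)
  (hDdef : sweep_inv m n D = North :: B ++ A ++ nseq k East) :
  cobounce k n D = cobounce k n' D' + r
  /\ (bounce m n D)%:Z = (bounce m' n' D')%:Z + n'%:Z * k%:Z - r.
Proof.
have dAB : dyck m' n' (A ++ B).
  by rewrite -hcut; apply: sweep_inv_dyck; rewrite hcut; case: (A) hB.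
have dNBAE : dyck m n (North :: B ++ A ++ nseq k East).
  by rewrite -hDdef; apply: sweep_inv_dyck; rewrite hDdef.
have cobounceD : cobounce k n D = cobounce k n' D' + r.
  have /andP[/eqP endAB _] := dAB; subst m m'.
  rewrite (cobounce_inversions hDdef dNBAE) (cobounce_inversions hcut dAB).
  by rewrite -hrank -(inversions_catC endAB) /= catA inversions_cat_nseq_East.
have bin2_n : 'C(n, 2) = ('C(n', 2) + n')%N.
  by have -> : n = n'.+1; [lia | rewrite binS bin1].
by split=> //; move: cobounceD; rewrite /cobounce -hm -hm' bin2_n; lia.
Qed.
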